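(* Let $R$ be a unitary ring, let $d\in R$ be regular and let $a\in R$ be invertible along $d$. Then the following statements are equivalent. (i) $a^{\parallel d}$ is an inner inverse of $a$. (ii) $R=dR\oplus a^{-1}(0)$. (iii) $R=Rd\oplus a_{-1}(0)$.
   Context: $R$ is an associative ring with unit $1$. For $c\in R$: $cR=\{cx: x\in R\}$, $Rc=\{xc: x\in R\}$, $c^{-1}(0)=\{x\in R: cx=0\}$, $c_{-1}(0)=\{x\in R: xc=0\}$. An element $d$ is regular if there is $z\in R$ with $d=dzd$. An element $z$ is an inner inverse of $a$ if $a=aza$. An element $a$ is invertible along $d$ if there is $b\in R$ with $b=bab$, $bR=dR$ and $Rb=Rd$; such $b$ is unique and is denoted $a^{\parallel d}$. The symbol $\oplus$ denotes (internal) direct sum of additive subgroups. *)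

(* Defs.v *)
From HB Require Import structures.
From mathcomp Require Import all_boot all_order all_algebra.
From mathcomp Require Import boolp classical_sets.

Set Implicit Arguments.
Unset Strict Implicit.
Unset Printing Implicit Defensive.

Import GRing.Theory.
Local Open Scope classical_set_scope.
Local Open Scope ring_scope.

Section InverseAlong.
(* [pzRingType] is the class of associative unital rings, the zero ring
   included. *)
Variable R : pzRingType.
Implicit Types (a b c d x z : R) (A B : set R).

Definition right_ideal c : set R := [set c * x | x in [set: R]].
Definition left_ideal c : set R := [set x * c | x in [set: R]].

(* c^{-1}(0), the kernel of x |-> c x *)
Definition right_ann c : set R := [set x | c * x = 0].
(* c_{-1}(0), the kernel of x |-> x c *)
Definition left_ann c : set R := [set x | x * c = 0].

Definition inner_inverse a z : Prop := a = a * z * a.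
Definition regular_elt d : Prop := exists z, inner_inverse d z.

Definition is_inverse_along a d b : Prop :=
  [/\ b = b * a * b, right_ideal b = right_ideal d
    & left_ideal b = left_ideal d].

Definition invertible_along a d : Prop := exists b, is_inverse_along a d b.

(* The default value 0 is only taken when a is not invertible along d. *)
Definition inverse_along a d : R := xget 0 [set b | is_inverse_along a d b].

Lemma is_inverse_along_uniq a d b c :
  is_inverse_along a d b -> is_inverse_along a d c -> b = c.
Proof.
move=> [bab bR Rb] [cac cR Rc].
have [x _ cx] : right_ideal c b by rewrite cR -bR; exists 1; rewrite ?mulr1.
have [y _ yb] : left_ideal b c by rewrite Rb -Rc; exists 1; rewrite ?mul1r.
have <- : c * a * b = b by rewrite -cx mulrA -cac.
by rewrite -{1}yb -!mulrA [b * (a * b)]mulrA -bab.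
Qed.

Lemma inverse_alongP a d :
  invertible_along a d -> is_inverse_along a d (inverse_along a d).
Proof. by move=> [b ab]; apply: (@xgetPex _ 0 (is_inverse_along a d)); exists b. Qed.

Lemma inverse_along_eq a d b : is_inverse_along a d b -> inverse_along a d = b.
Proof.
move=> ab; apply: is_inverse_along_uniq (ab).
by apply: inverse_alongP; exists b.
Qed.

(* R is the internal direct sum of its additive subgroups A and B. *)
Definition ring_direct_sum A B : Prop :=
  [/\ zmod_closed [in A], zmod_closed [in B],
      [set: R] = [set u + v | u in A & v in B]
    & A `&` B = [set 0]].

End InverseAlong.

(* Main.v *)
Require Import Defs.
From HB Require Import structures.
From mathcomp Require Import all_boot all_order all_algebra.
From mathcomp Require Import boolp classical_sets.

(** Let [b] be the inverse of [a] along [d]. Since [dR = bR] and [Rd = Rb],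
    both decompositions can be read off [b]. From [b = bab], the element [ba]
    is an idempotent that generates [bR], so [R] is the direct sum of [bR] and
    the kernel of [x |-> bax]. That kernel contains the kernel of
    [x |-> ax], and they coincide exactly when [a (1 - ba) = 0], that is, when
    [a = aba]. This gives the equivalence of (i) and (ii)
    ([inner_inverse_right_direct_sum]). Condition (i) and the notion of inverse
    along an element are left-right symmetric, so the equivalence of (i) and
    (iii) is the same result read in the opposite ring. *)

Import GRing.Theory.
Local Open Scope classical_set_scope.
Local Open Scope ring_scope.

Lemma right_ideal_zmod_closed (R : pzRingType) (c : R) :
  zmod_closed [in right_ideal c].
Proof.
split; first by rewrite !inE; exists 0; rewrite ?mulr0.
move=> u v; rewrite !inE => -[x _ <-] [y _ <-].
by exists (x - y); rewrite ?mulrBr.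
Qed.

Lemma right_ann_zmod_closed (R : pzRingType) (c : R) :
  zmod_closed [in right_ann c].
Proof.
split; first by rewrite !inE /right_ann /= mulr0.
move=> u v; rewrite !inE /right_ann /= => cu cv.
by rewrite mulrBr cu cv subr0.
Qed.

(** The Peirce decomposition [x = bax + (x - bax)] gives the direct sum.
    Conversely, if [1 = by + k] with [ak = 0], then [a = aby], and [aba = a]
    because [bab = b] absorbs the extra factor. *)
Lemma inner_inverse_right_direct_sum (R : pzRingType) (a d b : R) :
  is_inverse_along a d b ->
  inner_inverse a b <-> ring_direct_sum (right_ideal d) (right_ann a).
Proof.
move=> [bab <- _]; split=> [aba | [_ _ sumT _]].
  split.
  - exact: right_ideal_zmod_closed.
  - exact: right_ann_zmod_closed.
  - apply/seteqP; split=> // x _.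
    exists (b * (a * x)); first by exists (a * x).
    exists (x - b * (a * x)); last by rewrite addrC subrK.
    by rewrite /right_ann /= mulrBr !mulrA -aba subrr.
  - apply/seteqP; split=> [_ [[y _ <-]]| _ ->].
      by rewrite /right_ann /= => aby0; rewrite bab -!mulrA aby0 mulr0.
    by split; [exists 0; rewrite ?mulr0 | rewrite /right_ann /= mulr0].
have : [set: R] 1 by [].
rewrite sumT => -[_ [y _ <-]] [k ak0 sum1].
have a_aby : a = a * (b * y) by rewrite -[LHS]mulr1 -sum1 mulrDr ak0 addr0.
have baby : b * (a * (b * y)) = b * y by rewrite !mulrA -bab.
by rewrite /inner_inverse {3}a_aby -mulrA baby.
Qed.

Lemma is_inverse_along_converse (R : pzRingType) (a d b : R) :
  is_inverse_along a d b -> @is_inverse_along R^c a d b.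
Proof.
move=> [bab bR Rb]; split=> //.
exact: etrans bab (esym (mulrA b a b)).
Qed.

Lemma inner_inverse_converse (R : pzRingType) (a b : R) :
  inner_inverse a b <-> @inner_inverse R^c a b.
Proof.
by split=> aba; [exact: etrans aba (esym (mulrA a b a))
                | exact: etrans aba (mulrA a b a)].
Qed.

Lemma inner_inverse_left_direct_sum (R : pzRingType) (a d b : R) :
  is_inverse_along a d b ->
  inner_inverse a b <-> ring_direct_sum (left_ideal d) (left_ann a).
Proof.
move=> /is_inverse_along_converse/inner_inverse_right_direct_sum inner_iff.
exact: iff_trans (inner_inverse_converse _ a b) inner_iff.
Qed.

Theorem theorem7p1 (R : pzRingType) (a d : R)
    (hd : regular_elt d) (ha : invertible_along a d) :
  [<-> inner_inverse a (inverse_along a d);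
       ring_direct_sum (right_ideal d) (right_ann a);
       ring_direct_sum (left_ideal d) (left_ann a)].
Proof.
have along := inverse_alongP ha.
have right_iff := inner_inverse_right_direct_sum _ _ _ _ along.
have left_iff := inner_inverse_left_direct_sum _ _ _ _ along.
tfae.
- by move/right_iff.
- by move/right_iff/left_iff.
- by move/left_iff.
Qed.
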